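(* Let $G$ be a group, let $\alpha=\{\alpha_g:\mathcal D_{g^{-1}}\to\mathcal D_g\mid g\in G\}$ be a unital partial action of $G$ on a commutative ring $\mathcal A$, let $n>0$ and let $w\in Z^n(G,\mathcal A)$ be a partial $n$-cocycle. Then $w$ is globalizable (i.e. there exists a globalization of $w$) if and only if there exists a function $\widetilde w:G^n\to\mathcal U(\mathcal A)$ such that for all $x_1,\dots,x_{n+1}\in G$ $$\alpha_{x_1}\left(1_{x_1^{-1}}\widetilde w(x_2,\dots,x_{n+1})\right)\prod_{i=1}^n\widetilde w(x_1,\dots,x_ix_{i+1},\dots,x_{n+1})^{(-1)^i}\cdot\widetilde w(x_1,\dots,x_n)^{(-1)^{n+1}}=1_{x_1}$$ and $$w(x_1,\dots,x_n)=1_{(x_1,\dots,x_n)}\,\widetilde w(x_1,\dots,x_n).$$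
   Context: Rings are associative, not necessarily unital; $\mathcal U(\cdot)$ denotes the group of invertible elements. A partial action $\alpha$ of a group $G$ (identity $1$) on a ring $\mathcal A$ is a collection of two-sided ideals $\mathcal D_g\subseteq\mathcal A$ and ring isomorphisms $\alpha_g:\mathcal D_{g^{-1}}\to\mathcal D_g$ ($g\in G$) such that (i) $\mathcal D_1=\mathcal A$, $\alpha_1=\mathrm{id}$; (ii) $\alpha_g(\mathcal D_{g^{-1}}\cap\mathcal D_h)=\mathcal D_g\cap\mathcal D_{gh}$; (iii) $\alpha_g(\alpha_h(a))=\alpha_{gh}(a)$ for $a\in\mathcal D_{h^{-1}}\cap\mathcal D_{h^{-1}g^{-1}}$. It is unital if every $\mathcal D_g=1_g\mathcal A$ for an idempotent $1_g$ central in $\mathcal A$ (so $\mathcal A$ has identity $1_{\mathcal A}=1_1$). Partial cohomology ($\mathcal A$ commutative, $\alpha$ unital). For $n\ge1$ put $1_{(x_1,\dots,x_n)}=1_{x_1}1_{x_1x_2}\cdots1_{x_1\cdots x_n}$ and $\mathcal D_{(x_1,\dots,x_n)}=1_{(x_1,\dots,x_n)}\mathcal A$. $C^n(G,\mathcal A)$ is the abelian group (pointwise multiplication) of functions $f:G^n\to\mathcal A$ with $f(x_1,\dots,x_n)$ invertible in the ideal $\mathcal D_{(x_1,\dots,x_n)}$ (whose identity is $1_{(x_1,\dots,x_n)}$); inverses of values of $f$ are taken in these ideals. $C^0(G,\mathcal A)=\mathcal U(\mathcal A)$. For $n\ge 1$ the coboundary is $(\delta^nf)(x_1,\dots,x_{n+1})=\alpha_{x_1}(1_{x_1^{-1}}f(x_2,\dots,x_{n+1}))\prod_{i=1}^nf(x_1,\dots,x_ix_{i+1},\dots,x_{n+1})^{(-1)^i}\cdot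 f(x_1,\dots,x_n)^{(-1)^{n+1}}$, and $(\delta^0a)(x)=\alpha_x(1_{x^{-1}}a)a^{-1}$. $Z^n(G,\mathcal A)=\ker\delta^n$. Inverses of values of $\widetilde w$ are taken in $\mathcal A$. Globalization. An enveloping action of $\alpha$ is a (global) action $\beta$ of $G$ by automorphisms on a ring $\mathcal B$ together with an injective ring homomorphism $\varphi:\mathcal A\to\mathcal B$ such that $\varphi(\mathcal A)$ is a two-sided ideal of $\mathcal B$, $\varphi(\mathcal D_g)=\varphi(\mathcal A)\cap\beta_g(\varphi(\mathcal A))$, $\varphi(\alpha_g(a))=\beta_g(\varphi(a))$ for $a\in\mathcal D_{g^{-1}}$, and $\mathcal B=\sum_{g\in G}\beta_g(\varphi(\mathcal A))$. It is known that it exists for unital $\alpha$ on a unital ring and is unique up to isomorphism; concretely one may take $\mathcal B=\sum_{g}\beta_g(\varphi(\mathcal A))$ inside the ring $\mathcal F(G,\mathcal A)$ of all functions $G\to\mathcal A$, with $\beta_x(f)(t)=f(x^{-1}t)$ and $\varphi(a)(t)=\alpha_{t^{-1}}(1_ta)$. The multiplier ring $\mathcal M(\mathcal B)$ is the ring of pairs $u=(R,L)$ of a left $\mathcal B$-module endomorphism $R$ (written on the right) and a right $\mathcal B$-module endomorphism $L$ of $\mathcal B$ with $(aR)b=a(Lb)$ for all $a,b\in\mathcal B$; one writes $au=aR$, $ua=La$. For commutative $\mathcal A$, both $\mathcal B$ and $\mathcal M(\mathcal B)$ are commutative. $G$ acts on $\mathcal M(\mathcal B)$ by $\beta^*_g(u)=\beta_gu\beta_g^{-1}=(\beta_g^{-1}R\beta_g,\beta_gL\beta_g^{-1})$,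 and $\mathcal U(\mathcal M(\mathcal B))$ is a $G$-module via $\beta^*$. A globalization of $w\in Z^n(G,\mathcal A)$ is a classical $n$-cocycle $u\in Z^n(G,\mathcal U(\mathcal M(\mathcal B)))$ with $\varphi(w(x_1,\dots,x_n))=\varphi(1_{(x_1,\dots,x_n)})u(x_1,\dots,x_n)$ for all $x_1,\dots,x_n\in G$. *)

(* Defs.v *)
From HB Require Import structures.
From mathcomp Require Import all_boot all_order all_fingroup all_algebra.
From mathcomp Require Import boolp classical_sets functions.

Set Implicit Arguments.
Unset Strict Implicit.
Unset Printing Implicit Defensive.

Import GRing.Theory.
Local Open Scope classical_set_scope.
Local Open Scope ring_scope.

(* The enveloping ring of a partial action has no identity in general, so it
   cannot be a pzRingType. *)
HB.mixin Record Zmodule_isRng B of GRing.Zmodule B := {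
  rmul : B -> B -> B;
  rmulA : associative rmul;
  rmulDl : left_distributive rmul +%R;
  rmulDr : right_distributive rmul +%R;
}.

#[short(type="rngType")]
HB.structure Definition Rng := {B of Zmodule_isRng B & GRing.Zmodule B}.

Section Invertibility.
Variable A : pzRingType.
Implicit Types e a b : A.

(* For a central idempotent e, eA is a ring with identity e, and the following
   is the invertibility of a in that ring.  For e = 1 it is invertibility in
   A; GRing.unit is not used because unitRingType excludes the zero ring. *)
Definition inverse_in e a b : Prop :=
  [/\ range ( *%R e) a, range ( *%R e) b, a * b = e & b * a = e].

Definition invertible_in e a : Prop := exists b, inverse_in e a b.

(* The default value a is returned when a is not invertible in eA. *)
Definition inv_in e a : A := xget a [set b | inverse_in e a b].

End Invertibility.

Section Coboundary.
Variables (G : groupType) (n : nat).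
Implicit Types x : {ffun 'I_n.+1 -> G}.

Definition face_first x : {ffun 'I_n -> G} := [ffun j => x (lift ord0 j)].

Definition face_last x : {ffun 'I_n -> G} :=
  [ffun j => x (widen_ord (leqnSn n) j)].

(* With x = (x_1, ..., x_{n+1}), face_mul k x is
   (x_1, ..., x_i x_{i+1}, ..., x_{n+1}) for i = k + 1. *)
Definition face_mul (k : 'I_n) x : {ffun 'I_n -> G} :=
  [ffun j : 'I_n => if (j < k)%N then x (widen_ord (leqnSn n) j)
                    else if j == k
                    then (x (widen_ord (leqnSn n) j) * x (lift ord0 j))%g
                    else x (lift ord0 j)].

(* finv y stands for the inverse of f y; in which ring the inverse is taken
   may depend on y. *)
Definition coboundary (A : pzRingType) (act : G -> A -> A)
    (f finv : {ffun 'I_n -> G} -> A) x : A :=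
  let fsgn (i : nat) y := if odd i then finv y else f y in
  act (x ord0) (f (face_first x))
  * (\prod_(k < n) fsgn k.+1 (face_mul k x))
  * fsgn n.+1 (face_last x).

End Coboundary.

Definition unit_cocycle (G : groupType) (R : pzRingType) (act : G -> R -> R)
    (n : nat) (u : {ffun 'I_n -> G} -> R) : Prop :=
  (forall y, invertible_in 1 (u y)) /\
  (forall x, coboundary act u (fun y => inv_in 1 (u y)) x = 1).

Definition ideal (A : pzRingType) (I : set A) : Prop :=
  [/\ I 0, forall a b, I a -> I b -> I (a - b),
      forall c a, I a -> I (c * a) & forall c a, I a -> I (a * c)].

(* pact g is a total function of which only the restriction to pdom g^-1 is
   meaningful. *)
Record partialAction (G : groupType) (A : pzRingType) := PartialAction {
  pdom : G -> set A;
  pact : G -> A -> A;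
  pdom_ideal : forall g, ideal (pdom g);
  pact_bij : forall g, set_bij (pdom g^-1%g) (pdom g) (pact g);
  pactD : forall g a b, pdom g^-1%g a -> pdom g^-1%g b ->
    pact g (a + b) = pact g a + pact g b;
  pactM : forall g a b, pdom g^-1%g a -> pdom g^-1%g b ->
    pact g (a * b) = pact g a * pact g b;
  pdom1 : pdom 1%g = setT;
  pact1 : forall a, pact 1%g a = a;
  pact_domI : forall g h,
    pact g @` (pdom g^-1%g `&` pdom h) = pdom g `&` pdom (g * h)%g;
  pact_comp : forall g h a, pdom h^-1%g a -> pdom (h^-1 * g^-1)%g a ->
    pact g (pact h a) = pact (g * h)%g a
}.

Record unitalPartialAction (G : groupType) (A : pzRingType) :=
  UnitalPartialAction {
  upa :> partialAction G A;
  pone : G -> A;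
  pone_idem : forall g, pone g * pone g = pone g;
  pone_central : forall g a, pone g * a = a * pone g;
  pdom_pone : forall g, pdom upa g = range ( *%R (pone g))
}.

Section PartialCohomology.
Variables (G : groupType) (A : pzRingType) (alpha : unitalPartialAction G A).

(* 1_(x_1, ..., x_n) = 1_(x_1) 1_(x_1 x_2) ... 1_(x_1 ... x_n) *)
Definition pone_tuple n (x : {ffun 'I_n -> G}) : A :=
  \prod_(k < n) pone alpha (\big[*%g/1%g]_(j < n | (j <= k)%N) x j).

Definition pact_cut (g : G) (a : A) : A :=
  pact alpha g (pone alpha g^-1%g * a).

Definition partial_cochain n (f : {ffun 'I_n -> G} -> A) : Prop :=
  forall x, invertible_in (pone_tuple x) (f x).

Definition partial_coboundary n (f : {ffun 'I_n -> G} -> A) :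
    {ffun 'I_n.+1 -> G} -> A :=
  coboundary pact_cut f (fun y => inv_in (pone_tuple y) (f y)).

Definition partial_cocycle n (f : {ffun 'I_n -> G} -> A) : Prop :=
  partial_cochain f /\ forall x, partial_coboundary f x = pone_tuple x.

End PartialCohomology.

(* Each gact g is bijective, with inverse gact g^-1, by gact1 and gact_comp. *)
Record globalAction (G : groupType) (B : rngType) := GlobalAction {
  gact :> G -> B -> B;
  gactD : forall g a b, gact g (a + b) = gact g a + gact g b;
  gactM : forall g a b, gact g (rmul a b) = rmul (gact g a) (gact g b);
  gact1 : forall a, gact 1%g a = a;
  gact_comp : forall g h a, gact g (gact h a) = gact (g * h)%g a
}.

Record envelopingAction (G : groupType) (A : pzRingType)
    (alpha : partialAction G A) := EnvelopingAction {
  env_ring : rngType;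
  env_act : globalAction G env_ring;
  env_emb : A -> env_ring;
  env_embD : forall a b, env_emb (a + b) = env_emb a + env_emb b;
  env_embM : forall a b, env_emb (a * b) = rmul (env_emb a) (env_emb b);
  env_emb_inj : injective env_emb;
  env_ideall : forall b a, range env_emb (rmul b (env_emb a));
  env_idealr : forall b a, range env_emb (rmul (env_emb a) b);
  env_dom : forall g, env_emb @` pdom alpha g =
    range env_emb `&` (env_act g @` range env_emb);
  env_equiv : forall g a, pdom alpha g^-1%g a ->
    env_emb (pact alpha g a) = env_act g (env_emb a);
  env_gen : forall b, exists s : seq (G * A),
    b = \sum_(p <- s) env_act p.1 (env_emb p.2)
}.

Section Multiplier.
Variable B : rngType.

(* multR u a is a u = a R and multL u a is u a = L a, for u = (R, L). *)
Record multiplier := Multiplier {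
  multR : B -> B;
  multL : B -> B;
  multRD : forall a b, multR (a + b) = multR a + multR b;
  multLD : forall a b, multL (a + b) = multL a + multL b;
  multRM : forall a b, multR (rmul a b) = rmul a (multR b);
  multLM : forall a b, multL (rmul a b) = rmul (multL a) b;
  mult_compat : forall a b, rmul (multR a) b = rmul a (multL b)
}.

Lemma multiplier_eq (u v : multiplier) :
  multR u =1 multR v -> multL u =1 multL v -> u = v.
Proof.
case: u v => [R L p1 p2 p3 p4 p5] [R' L' q1 q2 q3 q4 q5] /= /funext eR /funext eL.
by subst R' L'; congr Multiplier; apply: Prop_irrelevance.
Qed.

Lemma rmul0r (a : B) : rmul 0 a = 0.
Proof. by apply: (addrI (rmul 0 a)); rewrite -rmulDl !addr0. Qed.

Lemma rmulr0 (a : B) : rmul a 0 = 0.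
Proof. by apply: (addrI (rmul a 0)); rewrite -rmulDr !addr0. Qed.

Lemma rmulNr (a b : B) : rmul (- a) b = - rmul a b.
Proof. by apply: (addrI (rmul a b)); rewrite -rmulDl !subrr rmul0r. Qed.

Lemma rmulrN (a b : B) : rmul a (- b) = - rmul a b.
Proof. by apply: (addrI (rmul a b)); rewrite -rmulDr !subrr rmulr0. Qed.

Program Definition mult0 : multiplier := @Multiplier (fun=> 0) (fun=> 0) _ _ _ _ _.
Next Obligation. by rewrite addr0. Qed.
Next Obligation. by rewrite addr0. Qed.
Next Obligation. by rewrite rmulr0. Qed.
Next Obligation. by rewrite rmul0r. Qed.
Next Obligation. by rewrite rmulr0 rmul0r. Qed.

Program Definition multN (u : multiplier) : multiplier :=
  @Multiplier (fun a => - multR u a) (fun a => - multL u a) _ _ _ _ _.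
Next Obligation. by rewrite multRD opprD. Qed.
Next Obligation. by rewrite multLD opprD. Qed.
Next Obligation. by rewrite multRM rmulrN. Qed.
Next Obligation. by rewrite multLM rmulNr. Qed.
Next Obligation. by rewrite rmulNr rmulrN mult_compat. Qed.

Program Definition multA (u v : multiplier) : multiplier :=
  @Multiplier (fun a => multR u a + multR v a) (fun a => multL u a + multL v a)
    _ _ _ _ _.
Next Obligation. by rewrite !multRD addrACA. Qed.
Next Obligation. by rewrite !multLD addrACA. Qed.
Next Obligation. by rewrite !multRM rmulDr. Qed.
Next Obligation. by rewrite !multLM rmulDl. Qed.
Next Obligation. by rewrite rmulDl rmulDr !mult_compat. Qed.

Program Definition mult1 : multiplier := @Multiplier id id _ _ _ _ _.

(* a (u v) = (a u) v and (u v) a = u (v a) *)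
Program Definition multM (u v : multiplier) : multiplier :=
  @Multiplier (fun a => multR v (multR u a)) (fun a => multL u (multL v a))
    _ _ _ _ _.
Next Obligation. by rewrite !multRD. Qed.
Next Obligation. by rewrite !multLD. Qed.
Next Obligation. by rewrite !multRM. Qed.
Next Obligation. by rewrite !multLM. Qed.
Next Obligation. by rewrite !mult_compat. Qed.

HB.instance Definition _ := gen_eqMixin multiplier.
HB.instance Definition _ := gen_choiceMixin multiplier.

Fact multA_assoc : associative multA.
Proof. by move=> u v w; apply: multiplier_eq => a /=; rewrite addrA. Qed.
Fact multA_comm : commutative multA.
Proof. by move=> u v; apply: multiplier_eq => a /=; rewrite addrC. Qed.
Fact mult0A : left_id mult0 multA.
Proof. by move=> u; apply: multiplier_eq => a /=; rewrite add0r. Qed.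
Fact multNA : left_inverse mult0 multN multA.
Proof. by move=> u; apply: multiplier_eq => a /=; rewrite addNr. Qed.
Fact multM_assoc : associative multM.
Proof. by move=> u v w; apply: multiplier_eq. Qed.
Fact mult1M : left_id mult1 multM.
Proof. by move=> u; apply: multiplier_eq. Qed.
Fact multM1 : right_id mult1 multM.
Proof. by move=> u; apply: multiplier_eq. Qed.
Fact multMDl : left_distributive multM multA.
Proof. by move=> u v w; apply: multiplier_eq => a //=; rewrite multRD. Qed.
Fact multMDr : right_distributive multM multA.
Proof. by move=> u v w; apply: multiplier_eq => a //=; rewrite multLD. Qed.

HB.instance Definition _ := GRing.isZmodule.Build multiplier
  multA_assoc multA_comm mult0A multNA.
HB.instance Definition _ := GRing.Zmodule_isPzRing.Build multiplier
  multM_assoc mult1M multM1 multMDl multMDr.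

End Multiplier.

(* Maps written on the right compose from left to right: the right component
   of beta*_g u is a |-> beta_g ((beta_g^-1 a) R). *)
Program Definition mult_act (G : groupType) (B : rngType)
    (beta : globalAction G B) (g : G) (u : multiplier B) : multiplier B :=
  @Multiplier B (fun a => beta g (multR u (beta g^-1%g a)))
                (fun a => beta g (multL u (beta g^-1%g a))) _ _ _ _ _.
Next Obligation. by rewrite gactD multRD gactD. Qed.
Next Obligation. by rewrite gactD multLD gactD. Qed.
Next Obligation. by rewrite gactM multRM gactM gact_comp mulgV gact1. Qed.
Next Obligation. by rewrite gactM multLM gactM gact_comp mulgV gact1. Qed.
Next Obligation.
have gK c : beta g (beta g^-1%g c) = c by rewrite gact_comp mulgV gact1.
by rewrite -{1}[b]gK -gactM mult_compat gactM gK.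
Qed.

Section Globalization.
Variables (G : groupType) (A : pzRingType) (alpha : unitalPartialAction G A).
Variables (n : nat) (w : {ffun 'I_n -> G} -> A).

Definition globalization (E : envelopingAction alpha)
    (u : {ffun 'I_n -> G} -> multiplier (env_ring E)) : Prop :=
  unit_cocycle (mult_act (env_act E)) u /\
  forall x, env_emb E (w x) = multR (u x) (env_emb E (pone_tuple alpha x)).

(* The enveloping action is unique up to isomorphism. *)
Definition globalizable : Prop :=
  exists (E : envelopingAction alpha)
         (u : {ffun 'I_n -> G} -> multiplier (env_ring E)), globalization u.

End Globalization.

(* Main.v *)
Require Import Defs.
From HB Require Import structures.
From mathcomp Require Import all_boot all_order all_fingroup all_algebra.
From mathcomp Require Import zify.
From mathcomp Require Import boolp classical_sets functions.

(* If u globalizes w, then phi(1_A) u(x) lies in phi(A); this defines wt(x), and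
   u |-> phi^-1(phi(1_A) u) is a ring homomorphism from M(B) to A that
   intertwines beta* and alpha up to the idempotents 1_g.

   Conversely, take B inside the ring F(G, A) of functions and let
     u(x)(t) = prod_(i <= n) wt(d_(i+1)(t^-1, x_1, ..., x_n))^((-1)^i),
   where the d_i are the faces of an (n+1)-tuple.  This is the coboundary of
   (x_1, ..., x_(n-1)) |-> (t |-> wt(t^-1, x_1, ..., x_(n-1))), hence a cocycle
   with values in the units of F(G, A), and the identity satisfied by wt says
   that phi(wt(x)) = phi(1_A) u(x).  The same holds for inverses, so that
   u(x)^(+-1) phi(A) is contained in phi(A).  The cocycle identity writes
   beta_g^-1(u(x)) as a product of values of u and their inverses, so u(x) also
   preserves each beta_g(phi(A)): it is a multiplier of B. *)

Set Implicit Arguments.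
Unset Strict Implicit.
Unset Printing Implicit Defensive.

Import GRing.Theory.
Local Open Scope ring_scope.

(** * Face maps of tuples, seen as deletions of path vertices *)

Section Faces.
Variable G : groupType.

(** Vertex [k] of the path 1, x_1, x_1 x_2, ...; the default 1 for absent entries makes it total on
    [nat], so that vertices can be renumbered by [bump]. *)
Definition path_of n (x : {ffun 'I_n -> G}) (k : nat) : G :=
  \big[*%g/1%g]_(0 <= j < k) oapp x 1%g (insub j).

Definition steps n (s : nat -> G) : {ffun 'I_n -> G} :=
  [ffun j : 'I_n => ((s j)^-1 * s j.+1)%g].

(* The i-th face omits the i-th vertex of the path 1, x_1, x_1 x_2, ...; it is
   face_first for i = 0, face_mul k for i = k + 1 and face_last for i = n + 1. *)
Definition face n (i : nat) (x : {ffun 'I_n.+1 -> G}) : {ffun 'I_n -> G} :=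
  steps n (path_of x \o bump i).

Definition cons_ffun n (g : G) (x : {ffun 'I_n -> G}) : {ffun 'I_n.+1 -> G} :=
  [ffun i => oapp x g (unlift ord0 i)].

Lemma path_of0 n (x : {ffun 'I_n -> G}) : path_of x 0 = 1%g.
Proof. by rewrite /path_of big_geq. Qed.

Lemma path_ofS n (x : {ffun 'I_n -> G}) (i : 'I_n) :
  path_of x i.+1 = (path_of x i * x i)%g.
Proof. by rewrite /path_of big_nat_recr //= valK. Qed.

Lemma step_path n (x : {ffun 'I_n -> G}) (i : 'I_n) :
  ((path_of x i)^-1 * path_of x i.+1)%g = x i.
Proof. by rewrite path_ofS mulKg. Qed.

Lemma path_steps n (s : nat -> G) k : (k <= n)%N ->
  path_of (steps n s) k = ((s 0)^-1 * s k)%g.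
Proof.
elim: k => [|k IHk] lekn; first by rewrite path_of0 mulVg.
by rewrite (path_ofS _ (Ordinal lekn)) IHk 1?ltnW // ffunE /= mulgA mulgK.
Qed.

(** Increments are invariant under left translation. This is needed because [path_of] always starts
    at 1, also when the initial vertex has been omitted. *)
Lemma eq_steps n (g : G) (s s' : nat -> G) :
  (forall k, (k <= n)%N -> s k = (g * s' k)%g) -> steps n s = steps n s'.
Proof.
move=> eq_s; apply/ffunP=> j; rewrite !ffunE !eq_s ?(ltnW (ltn_ord j)) //.
by rewrite invMg mulgA mulgKV.
Qed.

(** The simplicial identity: both sides omit the same two vertices of one path, in either order. *)
Lemma face_face n i j (x : {ffun 'I_n.+2 -> G}) :
  face j (face i x) = face (unbump j i) (face (bump i j) x).
Proof.
have faceE a b : face b (face a x) = steps n (path_of x \o bump a \o bump b).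
  apply: (@eq_steps _ (path_of x (bump a 0))^-1%g) => k lek /=.
  by rewrite path_steps // (leq_add (leq_b1 _) lek).
by rewrite !faceE; congr (steps n _); apply/funext => k /=; rewrite bumpC.
Qed.

Lemma face0 n (x : {ffun 'I_n.+1 -> G}) : face 0 x = face_first x.
Proof. by apply/ffunP=> j; rewrite !ffunE; exact: (step_path x (lift ord0 j)). Qed.

Lemma faceS n (x : {ffun 'I_n.+1 -> G}) (k : 'I_n) :
  face k.+1 x = face_mul k x.
Proof.
apply/ffunP=> j; rewrite !ffunE /= /bump ltnS -(inj_eq val_inj) /=.
case: ltngtP => [ltjk|ltkj|eqjk].
- exact: (step_path x (lift ord0 j)).
- exact: (step_path x (widen_ord _ j)).
- set i := widen_ord _ j; set i' := lift ord0 j.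
  have -> : (true + j.+1)%N = i'.+1 by [].
  by rewrite path_ofS mulgA; congr (_ * _)%g; exact: (step_path x i).
Qed.

Lemma face_max n (x : {ffun 'I_n.+1 -> G}) : face n.+1 x = face_last x.
Proof.
apply/ffunP=> j; rewrite !ffunE /= /bump [(n < j)%N]ltnNge ltnW //= ltnS leqNgt ltn_ord.
exact: (step_path x (widen_ord _ j)).
Qed.

Lemma cons_ffun0 n g (x : {ffun 'I_n -> G}) : cons_ffun g x ord0 = g.
Proof. by rewrite ffunE unlift_none. Qed.

Lemma face0_cons n g (x : {ffun 'I_n -> G}) : face 0 (cons_ffun g x) = x.
Proof. by rewrite face0; apply/ffunP=> j; rewrite !ffunE liftK. Qed.

Lemma path_cons n g (x : {ffun 'I_n -> G}) k :
  (k <= n)%N -> path_of (cons_ffun g x) k.+1 = (g * path_of x k)%g.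
Proof.
elim: k => [|k IHk] lekn.
  by rewrite (path_ofS _ ord0) !path_of0 cons_ffun0 mul1g mulg1.
rewrite -[k.+1]/(nat_of_ord (lift ord0 (Ordinal lekn))) path_ofS IHk 1?ltnW //.
by rewrite ffunE liftK /= (path_ofS _ (Ordinal lekn)) mulgA.
Qed.

Lemma steps_path n (x : {ffun 'I_n -> G}) : steps n (path_of x) = x.
Proof. by apply/ffunP=> j; rewrite ffunE step_path. Qed.

(** Since [bump i 0] is 1 for [i = 0] and 0 otherwise, the new head is g x_1 if the vertex after g's
    own step disappears from the start of [x], and g in all other cases. *)
Lemma cons_face n i g (x : {ffun 'I_n.+1 -> G}) :
  cons_ffun (g * path_of x (bump i 0))%g (face i x) = face i.+1 (cons_ffun g x).
Proof.
rewrite -[LHS]steps_path; apply: (@eq_steps _ 1%g) => k lek /=.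
rewrite mul1g; case: k lek => [|k] lek; first by rewrite !path_of0.
rewrite path_cons // path_steps //= bumpS path_cons ?mulgA ?mulgK //.
exact: (@leq_add _ k 1 n (leq_b1 _) lek).
Qed.

Lemma cons_face0 n g (x : {ffun 'I_n.+1 -> G}) :
  cons_ffun (g * x ord0)%g (face 0 x) = face 1 (cons_ffun g x).
Proof. by rewrite -cons_face (path_ofS x ord0) path_of0 mul1g. Qed.

Lemma cons_faceS n i g (x : {ffun 'I_n.+1 -> G}) :
  cons_ffun g (face i.+1 x) = face i.+2 (cons_ffun g x).
Proof. by rewrite -cons_face path_of0 mulg1. Qed.

Lemma coboundaryE n (A : pzRingType) (act : G -> A -> A)
    (f finv : {ffun 'I_n -> G} -> A) (x : {ffun 'I_n.+1 -> G}) :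
  coboundary act f finv x = act (x ord0) (f (face 0 x)) *
    \prod_(k < n.+1) (if odd k.+1 then finv else f) (face k.+1 x).
Proof.
rewrite /coboundary face0 big_ord_recr /= face_max mulrA.
congr (_ * _ * _); last by case: odd.
by apply: eq_bigr => k _; rewrite faceS /=; case: odd.
Qed.

(** * Cancellation in an iterated alternating product over faces *)

Section AlternatingProduct.
Variables (A : comPzRingType) (n : nat) (f : bool -> {ffun 'I_n -> G} -> A).
Hypothesis f_inv : forall b x, f b x * f (~~ b) x = 1.

(** The coboundary without its first factor, with opposite exponents: face k + 1 gets (-1)^k. Taking
    [b = true] inverts the whole product. *)
Definition faces_prod (b : bool) (x : {ffun 'I_n.+1 -> G}) : A :=
  \prod_(k < n.+1) f (odd k (+) b) (face k.+1 x).

Lemma faces_prod_inv b x : faces_prod b x * faces_prod (~~ b) x = 1.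
Proof.
by rewrite -big_split big1 // => k _; rewrite /= addbN f_inv.
Qed.

(* The terms indexed by (i, j) and (bump i j, unbump j i) cancel. *)
Lemma faces_prod_faces_prod b (z : {ffun 'I_n.+2 -> G}) :
  \prod_(k < n.+2) faces_prod (odd k (+) b) (face k.+1 z) = 1.
Proof.
rewrite /faces_prod.
pose T (p : 'I_n.+2 * 'I_n.+1) :=
  f (odd p.2 (+) (odd p.1 (+) b)) (face p.2.+1 (face p.1.+1 z)).
rewrite (pair_bigA _ (fun i j => T (i, j))) /=.
rewrite (bigID (fun p : 'I_n.+2 * 'I_n.+1 => (p.1 <= p.2)%N)) /=.
(* An involution exchanging the pairs with [p.1 <= p.2] and the others; [flip_lt] shows that [inord]
   never takes its default value. *)
pose flip (p : 'I_n.+2 * 'I_n.+1) : 'I_n.+2 * 'I_n.+1 :=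
  (lift p.1 p.2, inord (unbump p.2 p.1)).
have flip_lt (p : 'I_n.+2 * 'I_n.+1) : (unbump p.2 p.1 < n.+1)%N.
  by case: p => [[i ltin] [j ltjn]] /=; rewrite /unbump; case: ltnP; lia.
have flip1 (p : 'I_n.+2 * 'I_n.+1) : (flip p).1 = bump p.1 p.2 :> nat by [].
have flip2 (p : 'I_n.+2 * 'I_n.+1) : (flip p).2 = unbump p.2 p.1 :> nat.
  by rewrite inordK.
have flipE (p : 'I_n.+2 * 'I_n.+1) :
    ((flip p).1 <= (flip p).2)%N && (flip (flip p) == p) = ~~ (p.1 <= p.2)%N.
  rewrite -pair_eqE /pair_eq -!(inj_eq (@ord_inj _)) !(flip1, flip2) /bump /unbump.
  by case: p => [[i ltin] [j ltjn]] /=; case: (ltnP j i) => /= ?; lia.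
rewrite (reindex_onto flip flip) /= => [|p lep]; last first.
  apply/eqP; rewrite -pair_eqE /pair_eq -!(inj_eq (@ord_inj _)) !(flip1, flip2).
  rewrite /bump /unbump.
  by case: p lep => [[i ltin] [j ltjn]] /=; lia.
rewrite (eq_bigl _ _ flipE) -big_split big1 // => p; rewrite -ltnNge => ltp.
suff : T (flip p) * T p = 1 by [].
(* For j < i the pair (i, j) flips to (j, i - 1): the double faces agree and the parities of the
   exponents differ. *)
rewrite /T flip1 flip2 [face p.2.+1 _]face_face bumpS unbumpS.
set y := face _ _; rewrite /bump leqNgt ltp /unbump ltp add0n.
by case: (nat_of_ord p.1) ltp => // i _; rewrite subn1 /= addNb addbN addbCA f_inv.
Qed.

End AlternatingProduct.
End Faces.

(** * The partial action extended to all of [A] by cutting with idempotents *)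

Section PactCut.
Variables (G : groupType) (A : comPzRingType) (alpha : unitalPartialAction G A).
Implicit Types (g h : G) (a b : A).
Local Notation "1_ g" := (pone alpha g)
  (at level 8, g at level 2, format "1_ g").
Local Notation P := (pact_cut alpha).

Lemma pdomP g a : pdom alpha g a <-> 1_ g * a = a.
Proof.
rewrite pdom_pone; split=> [[b _ <-]|<-]; last by exists a.
by rewrite mulrA pone_idem.
Qed.

Lemma pdom_mull g a b : pdom alpha g a -> pdom alpha g (a * b).
Proof. by move=> /pdomP ga; apply/pdomP; rewrite mulrA ga. Qed.

Lemma pdom_mulr g a b : pdom alpha g b -> pdom alpha g (a * b).
Proof. by rewrite mulrC; apply: pdom_mull. Qed.

Lemma pdom_one g : pdom alpha g (1_ g).
Proof. by apply/pdomP; rewrite pone_idem. Qed.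

Lemma pone1 : 1_ 1%g = 1.
Proof. by rewrite -[LHS]mulr1; apply/pdomP; rewrite pdom1. Qed.

Lemma pact_cutE g a : pdom alpha g^-1%g a -> P g a = pact alpha g a.
Proof. by move=> /pdomP ga; rewrite /pact_cut ga. Qed.

Lemma pact_cutD g : {morph P g : a b / a + b}.
Proof.
by move=> a b; rewrite /pact_cut mulrDr pactD //; exact/pdom_mull/pdom_one.
Qed.

Lemma pact_cutM g : {morph P g : a b / a * b}.
Proof.
move=> a b; rewrite /pact_cut -pactM; try exact/pdom_mull/pdom_one.
by rewrite mulrACA pone_idem.
Qed.

(** Both sides lie in D_g and D_gh. By [pact_domI] the right side is [P g b] with 1_h b = b, so it
    equals its product with [P g (1_ h)], which is [P g (1_ h)]. *)
Lemma pact_cut_pone g h : P g (1_ h) = 1_ g * 1_ (g * h)%g.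
Proof.
have [domPl domPr] : pdom alpha g (P g (1_ h)) /\ pdom alpha (g * h)%g (P g (1_ h)).
  suff : (pdom alpha g `&` pdom alpha (g * h)%g)%classic (P g (1_ h)) by [].
  rewrite -pact_domI; exists (1_ g^-1 * 1_ h) => //.
  by split; [exact/pdom_mull/pdom_one|exact/pdom_mulr/pdom_one].
have : (pdom alpha g `&` pdom alpha (g * h)%g)%classic (1_ g * 1_ (g * h)%g).
  by split; [exact/pdom_mull/pdom_one|exact/pdom_mulr/pdom_one].
rewrite -pact_domI => -[b [gb /pdomP hb]]; rewrite -pact_cutE // => eb.
rewrite -[RHS]eb -hb pact_cutM eb mulrC -mulrA.
by move/pdomP: domPr => ->; move/pdomP: domPl => ->.
Qed.

Lemma pact_cut_one g : P g 1 = 1_ g.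
Proof. by rewrite -pone1 pact_cut_pone mulg1 pone_idem. Qed.

Lemma pone_pact_cut g a : 1_ g * P g a = P g a.
Proof. by rewrite -pact_cut_one -pact_cutM mul1r. Qed.

Lemma pact_cut1 a : P 1%g a = a.
Proof. by rewrite /pact_cut invg1 pone1 mul1r pact1. Qed.

Lemma pact_cut_comp g h a : P g (P h a) = 1_ g * P (g * h)%g a.
Proof.
(* Moving the idempotent inside [P h] puts the argument in the domain where [pact_comp] applies. *)
have eq_h : 1_ g^-1 * P h a = P h (1_ (h^-1 * g^-1)%g * a).
  by rewrite pact_cutM pact_cut_pone mulgA mulgV mul1g -mulrA mulrCA pone_pact_cut.
rewrite {1}/pact_cut eq_h {1}/pact_cut pact_comp; last first.
- by rewrite mulrCA; exact/pdom_mull/pdom_one.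
- exact/pdom_mull/pdom_one.
rewrite mulrCA -invMg -[pact _ _ _]/(P (g * h)%g _) pact_cutM pact_cut_pone mulgK.
by rewrite mulrAC pone_pact_cut mulrC.
Qed.

End PactCut.

(** * The enveloping action inside the ring of functions from G to A *)

Section Envelope.
Variables (G : groupType) (A : comPzRingType) (alpha : unitalPartialAction G A).
Implicit Types (g h t : G) (a b : A) (f : G -> A).
Local Notation P := (pact_cut alpha).

Definition shift g f : G -> A := fun t => f (g^-1 * t)%g.

Definition emb a : G -> A := fun t => P t^-1%g a.

Definition in_env f : Prop :=
  exists s : seq (G * A), f = \sum_(p <- s) shift p.1 (emb p.2).

Lemma shiftM g f f' : shift g (f * f') = shift g f * shift g f'.
Proof. by []. Qed.

Lemma shift1 f : shift 1%g f = f.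
Proof. by apply/funext => t; rewrite /shift invg1 mul1g. Qed.

Lemma shift_comp g h f : shift g (shift h f) = shift (g * h)%g f.
Proof. by apply/funext => t; rewrite /shift invMg mulgA. Qed.

Lemma embD a b : emb (a + b) = emb a + emb b.
Proof. by apply/funext => t; rewrite /emb pact_cutD. Qed.

Lemma embM a b : emb (a * b) = emb a * emb b.
Proof. by apply/funext => t; rewrite /emb pact_cutM. Qed.

Lemma emb_at1 a : emb a 1%g = a.
Proof. by rewrite /emb invg1 pact_cut1. Qed.

Lemma emb_inj : injective emb.
Proof. by move=> a b eq_ab; rewrite -[a]emb_at1 eq_ab emb_at1. Qed.

Lemma emb0 : emb 0 = 0.
Proof. by apply: (addrI (emb 0)); rewrite -embD !addr0. Qed.

Lemma embN a : emb (- a) = - emb a.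
Proof. by apply: (addrI (emb a)); rewrite -embD !subrr emb0. Qed.

(** The idempotent left over by [pact_cut_comp] is absorbed by the value of [emb b]. Hence the image
    of [emb] is an ideal of the envelope. *)
Lemma shift_emb_mul g a b : shift g (emb a) * emb b = emb (P g a * b).
Proof.
apply/funext => t; rewrite /emb pact_cutM pact_cut_comp -mulrA mulrCA.
by rewrite pone_pact_cut mulrC {1}mulrfctE mulrC /shift invMg invgK.
Qed.

Lemma in_env_shift_emb g a : in_env (shift g (emb a)).
Proof. by exists [:: (g, a)]; rewrite big_seq1. Qed.

Lemma in_env0 : in_env 0.
Proof. by exists [::]; rewrite big_nil. Qed.

Lemma in_envD f f' : in_env f -> in_env f' -> in_env (f + f').
Proof. by move=> [s ->] [s' ->]; exists (s ++ s'); rewrite big_cat. Qed.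

Lemma in_env_ind (K : (G -> A) -> Prop) :
  K 0 -> (forall f f', K f -> K f' -> K (f + f')) ->
  (forall g a, K (shift g (emb a))) -> forall f, in_env f -> K f.
Proof. by move=> K0 KD Kg f [s ->]; apply: big_ind. Qed.

Lemma in_env_shift g f : in_env f -> in_env (shift g f).
Proof.
elim/in_env_ind=> {f} [|f f' envf envf'|h a]; first exact: in_env0.
- exact: in_envD.
- by rewrite shift_comp; exact: in_env_shift_emb.
Qed.

Lemma in_envN f : in_env f -> in_env (- f).
Proof.
elim/in_env_ind=> {f} [|f f' envf envf'|h a]; first by rewrite oppr0; exact: in_env0.
- by rewrite opprD; exact: in_envD.
- suff -> : - shift h (emb a) = shift h (emb (- a)) by exact: in_env_shift_emb.
  by rewrite embN.
Qed.

Lemma in_envM_emb f b : in_env f -> exists c, f * emb b = emb c.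
Proof.
elim/in_env_ind=> {f} [|f f' [c ec] [c' ec']|g a].
- by exists 0; rewrite mul0r emb0.
- by exists (c + c'); rewrite mulrDl ec ec' embD.
- by exists (P g a * b); rewrite shift_emb_mul.
Qed.

Lemma in_envM f f' : in_env f -> in_env f' -> in_env (f * f').
Proof.
move=> envf; elim/in_env_ind=> {f'} [|f1 f2 env1 env2|g b].
- by rewrite mulr0; exact: in_env0.
- by rewrite mulrDr; exact: in_envD.
(* Translation by g^-1 turns the second factor into [emb b]. *)
- have [c ec] := in_envM_emb b (in_env_shift g^-1%g envf).
  rewrite -[f]shift1 -(mulgV g) -shift_comp -shiftM ec; exact: in_env_shift_emb.
Qed.

Definition env_pred : {pred G -> A} := fun f => `[< in_env f >].

Fact env_pred_zmod : zmod_closed env_pred.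
Proof.
split=> [|f f' /asboolP envf /asboolP envf']; apply/asboolP; first exact: in_env0.
by apply: in_envD => //; exact: in_envN.
Qed.

HB.instance Definition _ := GRing.isZmodClosed.Build (G -> A) env_pred env_pred_zmod.

Record envelope := Envelope { env_val : G -> A; env_valP : env_val \in env_pred }.

HB.instance Definition _ := [isSub for env_val].
HB.instance Definition _ := [Choice of envelope by <:].
HB.instance Definition _ := [SubChoice_isSubZmodule of envelope by <:].

Lemma in_env_val (b : envelope) : in_env (val b).
Proof. exact/asboolP/(valP b). Qed.

Definition to_env f (envf : in_env f) : envelope := Sub f (asboolT envf).

Definition env_mul (b c : envelope) : envelope :=
  to_env (in_envM (in_env_val b) (in_env_val c)).

Fact env_mulA : associative env_mul.
Proof. by move=> b c d; apply: val_inj; rewrite /= mulrA. Qed.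
Fact env_mulDl : left_distributive env_mul +%R.
Proof. by move=> b c d; apply: val_inj; rewrite /= mulrDl. Qed.
Fact env_mulDr : right_distributive env_mul +%R.
Proof. by move=> b c d; apply: val_inj; rewrite /= mulrDr. Qed.

HB.instance Definition _ :=
  Zmodule_isRng.Build envelope env_mulA env_mulDl env_mulDr.

Definition env_shift g (b : envelope) : envelope :=
  to_env (in_env_shift g (in_env_val b)).

Program Definition envelope_action : globalAction G envelope :=
  @GlobalAction G envelope env_shift _ _ _ _.
Next Obligation. by apply: val_inj. Qed.
Next Obligation. by apply: val_inj. Qed.
Next Obligation. by apply: val_inj; rewrite /= shift1. Qed.
Next Obligation. by apply: val_inj; rewrite /= shift_comp. Qed.

Lemma in_env_emb a : in_env (emb a).
Proof. by rewrite -[emb a]shift1; exact: in_env_shift_emb. Qed.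

Definition env_emb_fun a : envelope := to_env (in_env_emb a).

(** At [t] the two sides differ by the factor 1_(t^-1), which is absorbed because a = 1_(g^-1) a. *)
Lemma shift_emb g a : pdom alpha g^-1%g a -> emb (P g a) = shift g (emb a).
Proof.
move=> /pdomP ga; apply/funext => t; rewrite /emb /shift pact_cut_comp invMg invgK.
by rewrite -ga pact_cutM pact_cut_pone mulgK mulrA [_ * (_ * _)]mulrCA pone_idem.
Qed.

Program Definition standard_envelope : envelopingAction alpha :=
  @EnvelopingAction G A alpha envelope envelope_action env_emb_fun _ _ _ _ _ _ _ _.
Next Obligation. by apply: val_inj; rewrite /= embD. Qed.
Next Obligation. by apply: val_inj; rewrite /= embM. Qed.
Next Obligation. by move=> a b [/emb_inj]. Qed.
Next Obligation.
have [c ec] := in_envM_emb a (in_env_val b).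
by exists c => //; apply: val_inj; rewrite /= ec.
Qed.
Next Obligation.
have [c ec] := in_envM_emb a (in_env_val b).
by exists c => //; apply: val_inj; rewrite /= mulrC ec.
Qed.
Next Obligation.
apply/seteqP; split=> [_ [a ga <-]|_ [[a _ <-] [_ [b _ <-]] eq_ab]].
  split; first by exists a.
  have [_ _ surj_g] := pact_bij alpha g.
  have [b gb <-] := surj_g _ ga.
  exists (env_emb_fun b); first by exists b.
  by apply: val_inj; rewrite /= -shift_emb // pact_cutE.
exists a => //; apply/pdomP.
(* This is the equality of functions [eq_ab] evaluated at 1 in G. *)
have <- : P g b = a; last by rewrite pone_pact_cut.
have /(congr1 (fun c => val c 1%g)) := eq_ab.
by rewrite /= emb_at1 /shift /emb mulg1 invgK.
Qed.
Next Obligation. by apply: val_inj; rewrite /= -shift_emb // pact_cutE. Qed.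
Next Obligation.
have [s es] := in_env_val b; exists s; apply: val_inj.
by rewrite raddf_sum /= [LHS]es.
Qed.

End Envelope.

(** * Inverses in a unital ring *)

Lemma inverse_in1 (R : pzRingType) (a b : R) :
  a * b = 1 -> b * a = 1 -> inverse_in 1 a b.
Proof. by move=> ab ba; split=> //; [exists a|exists b]; rewrite ?mul1r. Qed.

Lemma inv_in1E (R : pzRingType) (a b : R) : inverse_in 1 a b -> inv_in 1 a = b.
Proof.
move=> inv_ab; have [_ _ _ ba] := inv_ab; rewrite /inv_in.
by case: xgetP => [c _ [_ _ ac _]|/(_ b)//]; rewrite -[c]mul1r -ba -mulrA ac mulr1.
Qed.

Lemma inv_in1P (R : pzRingType) (a : R) :
  invertible_in 1 a -> a * inv_in 1 a = 1 /\ inv_in 1 a * a = 1.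
Proof. by case=> b inv_ab; rewrite (inv_in1E inv_ab); case: inv_ab. Qed.

(** * Restriction of multipliers to [A], and the direct implication *)

Section Restriction.
Variables (G : groupType) (A : comPzRingType) (alpha : unitalPartialAction G A).
Variable E : envelopingAction alpha.
Implicit Types (u v : multiplier (env_ring E)) (a : A) (g : G).

(** As phi(1) is idempotent, phi(1) u = phi(1) (phi(1) u), which lies in the ideal phi(A). *)
Lemma mult_restr_subproof u : exists a, env_emb E a = multR u (env_emb E 1).
Proof.
have [a _ ea] := env_idealr (multR u (env_emb E 1)) 1.
by exists a; rewrite ea -multRM -env_embM mulr1.
Qed.

Definition mult_restr u : A := sval (cid (mult_restr_subproof u)).

Lemma mult_restrE u a : env_emb E (a * mult_restr u) = multR u (env_emb E a).
Proof.
by rewrite env_embM /mult_restr; case: cid => /= b ->; rewrite -multRM -env_embM mulr1.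
Qed.

Lemma mult_restr1 : mult_restr 1 = 1.
Proof. by apply: (@env_emb_inj _ _ _ E); rewrite -[mult_restr 1]mul1r mult_restrE. Qed.

Lemma mult_restrM : {morph mult_restr : u v / u * v}.
Proof.
move=> u v; apply: (@env_emb_inj _ _ _ E).
by rewrite mult_restrE -[mult_restr u]mul1r -[mult_restr (_ * _)]mul1r !mult_restrE.
Qed.

(** In the envelope, phi(1_g) is beta_g(phi(1_(g^-1))), so that multiplying it by beta*_g(u) gives
    beta_g(phi(1_(g^-1)) u). *)
Lemma mult_restr_act g u :
  pone alpha g * mult_restr (mult_act (env_act E) g u) = pact_cut alpha g (mult_restr u).
Proof.
apply: (@env_emb_inj _ _ _ E); rewrite mult_restrE /=.
have domg : pdom alpha g^-1^-1%g (pone alpha g) by rewrite invgK; exact: pdom_one.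
rewrite -env_equiv // -pact_cutE // pact_cut_pone mulVg pone1 mulr1.
by rewrite -mult_restrE -env_equiv //; exact/pdom_mull/pdom_one.
Qed.

Lemma globalization_quasi_cocycle n (w : {ffun 'I_n -> G} -> A)
    (u : {ffun 'I_n -> G} -> multiplier (env_ring E)) :
  globalization w u ->
  [/\ forall x, invertible_in 1 (mult_restr (u x)),
      forall x : {ffun 'I_n.+1 -> G},
        coboundary (pact_cut alpha) (fun y => mult_restr (u y))
          (fun y => inv_in 1 (mult_restr (u y))) x = pone alpha (x ord0)
    & forall x, w x = pone_tuple alpha x * mult_restr (u x)].
Proof.
move=> [[u_inv u_coc] uw].
have restr_inv x : inverse_in 1 (mult_restr (u x)) (mult_restr (inv_in 1 (u x))).
  have [uV Vu] := inv_in1P (u_inv x).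
  by apply: inverse_in1; rewrite -mult_restrM ?uV ?Vu mult_restr1.
split=> [x|x|x]; first by eexists; exact: restr_inv.
- rewrite coboundaryE /= -mult_restr_act.
  (* The cocycle identity of [u] is restricted to [A] and multiplied by 1_(x_1), which
     [mult_restr_act] needs. *)
  transitivity (pone alpha (x ord0) * mult_restr 1); last by rewrite mult_restr1 mulr1.
  rewrite -(u_coc x) coboundaryE mult_restrM mulrA.
  rewrite (big_morph _ mult_restrM mult_restr1); congr (_ * _).
  by apply: eq_bigr => k _ /=; case: odd => //=; rewrite (inv_in1E (restr_inv _)).
- by apply: (@env_emb_inj _ _ _ E); rewrite uw mult_restrE.
Qed.

End Restriction.

(** * Multipliers of the envelope given by functions *)

Section MultiplicationBy.
Variables (G : groupType) (A : comPzRingType) (alpha : unitalPartialAction G A).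
Local Notation B := (envelope alpha).
Implicit Types (F : G -> A) (m : multiplier B).

Definition stable F : Prop := forall b, in_env alpha b -> in_env alpha (F * b).

Program Definition mult_by F (stF : stable F) : multiplier B :=
  let f (b : B) := to_env (stF _ (in_env_val b)) in
  @Multiplier _ f f _ _ _ _ _.
Next Obligation. by apply: val_inj; rewrite /= mulrDr. Qed.
Next Obligation. by apply: val_inj; rewrite /= mulrDr. Qed.
Next Obligation. by apply: val_inj; rewrite /= mulrCA. Qed.
Next Obligation. by apply: val_inj; rewrite /= mulrA. Qed.
Next Obligation. by apply: val_inj; rewrite /= -mulrA mulrCA. Qed.

(** A relation, so that identities between multipliers reduce to identities between functions
    without handling proofs of [stable]. *)
Definition acts_by m F : Prop :=
  forall b, val (multR m b) = F * val b /\ val (multL m b) = F * val b.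

Lemma acts_by_mult F (stF : stable F) : acts_by (mult_by stF) F.
Proof. by []. Qed.

Lemma acts_by_inj m m' F : acts_by m F -> acts_by m' F -> m = m'.
Proof.
move=> mF mF'; apply: multiplier_eq => b; apply: val_inj.
- by rewrite (mF b).1 (mF' b).1.
- by rewrite (mF b).2 (mF' b).2.
Qed.

Lemma acts_by1 : acts_by 1 1.
Proof. by move=> b; rewrite mul1r. Qed.

Lemma acts_byM m m' F F' : acts_by m F -> acts_by m' F' -> acts_by (m * m') (F * F').
Proof.
move=> mF mF' b; split.
- by rewrite [LHS](mF' _).1 (mF b).1 mulrCA mulrA.
- by rewrite [LHS](mF _).2 (mF' b).2 mulrA.
Qed.

Lemma acts_by_act g m F :
  acts_by m F -> acts_by (mult_act (envelope_action alpha) g m) (shift g F).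
Proof.
move=> mF b; have gK : shift g (shift g^-1%g (val b)) = val b.
  by rewrite shift_comp mulgV shift1.
by split; rewrite /= ?(mF _).1 ?(mF _).2 shiftM gK.
Qed.

End MultiplicationBy.

(** * The converse implication: a globalization built from [wt] *)

Section FromQuasiCocycle.
Variables (G : groupType) (A : comPzRingType) (alpha : unitalPartialAction G A).
Variables (n : nat) (wt : {ffun 'I_n -> G} -> A).
Hypothesis wt_inv : forall x, invertible_in 1 (wt x).
Hypothesis wt_coc : forall x : {ffun 'I_n.+1 -> G},
  coboundary (pact_cut alpha) wt (fun y => inv_in 1 (wt y)) x = pone alpha (x ord0).
Implicit Types (x : {ffun 'I_n -> G}) (t g : G) (b : bool).

Definition spow b x : A := if b then inv_in 1 (wt x) else wt x.

Lemma spow_inv b x : spow b x * spow (~~ b) x = 1.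
Proof. by have [] := inv_in1P (wt_inv x); case: b. Qed.

Definition cocycle_ext b x : G -> A := fun t => faces_prod spow b (cons_ffun t^-1%g x).

Lemma cocycle_ext_inv b x : cocycle_ext b x * cocycle_ext (~~ b) x = 1.
Proof. by apply/funext => t; exact/faces_prod_inv/spow_inv. Qed.

(** At [t], the identity for [wt] on (t^-1, x_1, ..., x_n) says that phi(wt(x)) times the inverse of
    u(x) is phi(1); the case [b = true] follows by inversion. *)
Lemma emb_spow b x : emb alpha (spow b x) = emb alpha 1 * cocycle_ext b x.
Proof.
have emb_wt : emb alpha (wt x) * cocycle_ext true x = emb alpha 1.
  apply/funext => t; have := wt_coc (cons_ffun t^-1%g x).
  rewrite coboundaryE cons_ffun0 face0_cons => coc.
  rewrite -[RHS]/(pact_cut alpha t^-1%g 1) pact_cut_one -coc.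
  congr (_ * _); apply: eq_bigr => k _.
  by rewrite addbT /spow /=; case: odd.
case: b => /=.
- by rewrite -[X in emb _ X * _](spow_inv true x) embM -mulrA emb_wt -embM mulr1.
- by rewrite -emb_wt -mulrA (cocycle_ext_inv true) mulr1.
Qed.

(** At [t] this is [faces_prod_faces_prod] for (t^-1, y_1, ..., y_(n+1)); its first face has head
    t^-1 y_1, which accounts for the shift. *)
Lemma cocycle_ext_cocycle b (y : {ffun 'I_n.+1 -> G}) :
  shift (y ord0) (cocycle_ext b (face 0 y)) *
    \prod_(k < n.+1) cocycle_ext (~~ odd k (+) b) (face k.+1 y) = 1.
Proof.
apply/funext => t.
transitivity (\prod_(k < n.+2)
  faces_prod spow (odd k (+) b) (face k.+1 (cons_ffun t^-1%g y))); last first.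
  exact: faces_prod_faces_prod spow_inv _ _.
rewrite [RHS]big_ord_recl -cons_face0 mulrfctE fct_prodE; congr (_ * _).
  by rewrite /shift /cocycle_ext invMg invgK.
by apply: eq_bigr => k _; rewrite /cocycle_ext cons_faceS.
Qed.

Lemma cocycle_ext_mul_emb b x a :
  cocycle_ext b x * emb alpha a = emb alpha (spow b x * a).
Proof.
by rewrite embM emb_spow mulrAC -embM mul1r mulrC.
Qed.

Lemma cocycle_ext_prod_mul_emb (m : nat) (c : nat -> bool)
    (v : nat -> {ffun 'I_n -> G}) a :
  (\prod_(k < m) cocycle_ext (c k) (v k)) * emb alpha a =
  emb alpha ((\prod_(k < m) spow (c k) (v k)) * a).
Proof.
apply: (big_rec2 (fun (F : G -> A) s => F * emb alpha a = emb alpha (s * a))).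
  by rewrite !mul1r.
by move=> k F s _ IH; rewrite -mulrA IH cocycle_ext_mul_emb mulrA.
Qed.

Lemma cocycle_ext_stable b x : stable alpha (cocycle_ext b x).
Proof.
move=> F; elim/in_env_ind=> {F} [|F F' envF envF'|g a].
- by rewrite mulr0; exact: in_env0.
- by rewrite mulrDr; exact: in_envD.
pose y := cons_ffun g^-1%g x.
pose V := \prod_(k < n.+1) cocycle_ext (~~ odd k (+) ~~ b) (face k.+1 y).
(* The cocycle identity is taken with [~~ b]: it makes [V] inverse to the translate of
   [cocycle_ext (~~ b) x]. *)
have VE : shift g^-1%g (cocycle_ext b x) = V.
  have := cocycle_ext_cocycle (~~ b) y; rewrite face0_cons cons_ffun0 -/V => cocV.
  rewrite -[LHS]mulr1 -cocV mulrA -shiftM cocycle_ext_inv.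
  by rewrite mul1r.
rewrite -[cocycle_ext b x]shift1 -(mulgV g) -shift_comp -shiftM VE.
rewrite (cocycle_ext_prod_mul_emb _ (fun k => ~~ odd k (+) ~~ b) (fun k => face k.+1 y)).
exact: in_env_shift_emb.
Qed.

Definition cocycle_ext_mult b x : multiplier (envelope alpha) :=
  mult_by (@cocycle_ext_stable b x).

Lemma cocycle_ext_mult_inverse x :
  inverse_in 1 (cocycle_ext_mult false x) (cocycle_ext_mult true x).
Proof.
have mul_neg b : cocycle_ext_mult b x * cocycle_ext_mult (~~ b) x = 1.
  apply: (acts_by_inj _ (@acts_by1 _ _ alpha)); rewrite -(cocycle_ext_inv b x).
  by apply: acts_byM; exact: acts_by_mult.
by apply: inverse_in1; [exact: (mul_neg false)|exact: (mul_neg true)].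
Qed.

Lemma cocycle_ext_mult_cocycle :
  unit_cocycle (mult_act (envelope_action alpha)) (cocycle_ext_mult false).
Proof.
split=> [x|y]; first by eexists; exact: cocycle_ext_mult_inverse.
rewrite coboundaryE; apply: (acts_by_inj _ (@acts_by1 _ _ alpha)).
rewrite -(cocycle_ext_cocycle false y); apply: acts_byM.
  exact/acts_by_act/acts_by_mult.
apply: (big_ind2 (@acts_by _ _ alpha)); first exact: acts_by1.
  by move=> ? ? ? ?; exact: acts_byM.
move=> k _ /=; rewrite addbF; case: odd => /=; first exact: acts_by_mult.
(* The inverse chosen by [inv_in] is [cocycle_ext_mult true]. *)
by rewrite (inv_in1E (cocycle_ext_mult_inverse _)); exact: acts_by_mult.
Qed.

Lemma quasi_cocycle_globalizable (w : {ffun 'I_n -> G} -> A) :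
  (forall x, w x = pone_tuple alpha x * wt x) -> globalizable alpha w.
Proof.
move=> wE; exists (standard_envelope alpha), (cocycle_ext_mult false).
split; first exact: cocycle_ext_mult_cocycle.
by move=> x; apply: val_inj; rewrite /= cocycle_ext_mul_emb wE mulrC.
Qed.

End FromQuasiCocycle.

Theorem theorem2p5 (G : groupType) (A : comPzRingType)
    (alpha : unitalPartialAction G A) (n : nat) (n_gt0 : (0 < n)%N)
    (w : {ffun 'I_n -> G} -> A) (wZ : partial_cocycle alpha w) :
  globalizable alpha w <->
  exists wt : {ffun 'I_n -> G} -> A,
    [/\ forall x, invertible_in 1 (wt x),
        forall x : {ffun 'I_n.+1 -> G},
          coboundary (pact_cut alpha) wt (fun y => inv_in 1 (wt y)) x
          = pone alpha (x ord0)
      & forall x, w x = pone_tuple alpha x * wt x].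
Proof.
split=> [[E [u uw]]|[wt [wt_inv wt_coc wE]]].
  by exists (fun x => mult_restr (u x)); exact: globalization_quasi_cocycle.
exact: quasi_cocycle_globalizable wE.
Qed.
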